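(* Let $(X_0,d_0,K_0)$ and $(X_1,d_1,K_1)$ be two set-assigned geodesic spaces with $$d_{GH}\big((X_0,d_0,K_0),(X_1,d_1,K_1)\big)<\epsilon .$$ Then there exists a set-assigned $2\epsilon$-isometry $f:(X_0,K_0)\to(X_1,K_1)$ with $$|u_{K_0}(x_0)-u_{K_1}(f(x_0))|<10\epsilon\quad\text{for any } x_0\in X_0 .$$
   Context: A geodesic space is a length space in which the distance between any two points is attained by the length of some Lipschitz curve connecting them. A set-assigned geodesic space $(X,d,K)$ is a complete, connected, locally compact, non-compact geodesic space $(X,d)$ together with a distinguished non-empty compact subset $K\subset X$. For such $(X,d,K)$, let $S_r(K)=\{x\in X: d(x,K)=r\}$ for $r>0$, and let $u_K:X\to\mathbb{R}$ be the $K$-assigned dl-function $u_K(x)=\lim_{r\to+\infty}[d(x,S_r(K))-r]$ (this limit exists for every $x$), where $d(x,H)=\inf_{h\in H}d(x,h)$. The Gromov–Hausdorff metric is $$d_{GH}((X_0,d_0,K_0),(X_1,d_1,K_1))=\inf_d\{d_H(X_0,X_1)+d_H(K_0,K_1)\}\in[0,+\infty],$$ where the infimum is over all admissible metrics $d$ on the disjoint union $X_0\sqcup X_1$, i.e. metrics with $d|_{X_0\times X_0}=d_0$ and $d|_{X_1\times X_1}=d_1$, and $d_H$ is the Hausdorff distance associated with $d$ (possibly infinite). For $\epsilon>0$, a map $f:(X_0,K_0)\to(X_1,K_1)$, i.e. a (not necessarily continuous) map $f:X_0\to X_1$, is a set-assigned $\epsilon$-isometry if (1) $\sup_{x,x'\in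 X_0}|d_0(x,x')-d_1(f(x),f(x'))|<\epsilon$, and (2) $f(X_0)$ is an $\epsilon$-net in $X_1$ and $f(K_0)$ is an $\epsilon$-net in $K_1$. Here an $\epsilon$-net in a metric space $Y$ is a subset $S\subseteq Y$ with $\mathrm{dist}(y,S)\le\epsilon$ for all $y\in Y$ (in particular $f(K_0)\subseteq K_1$). *)

(* Defs.v *)
From HB Require Import structures.
From mathcomp Require Import all_boot all_order all_algebra.
From mathcomp Require Import all_classical all_reals all_analysis.

Set Implicit Arguments.
Unset Strict Implicit.
Unset Printing Implicit Defensive.

Import Order.TTheory GRing.Theory Num.Theory.
Import numFieldNormedType.Exports.

Local Open Scope classical_set_scope.
Local Open Scope ring_scope.

(* Distances to sets and Hausdorff distances are taken with respect to a bare
   distance function [d], because they are needed both for the metric [mdist]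
   of a [metricType] and for the many admissible metrics on [X0 + X1]. *)
Section distance_function.
Context {R : realType} {T : Type}.
Implicit Types (d : T -> T -> R) (A B H : set T) (x : T).

Definition is_metric d : Prop :=
  [/\ forall x y, 0 <= d x y,
      forall x y, d x y = 0 <-> x = y,
      forall x y, d x y = d y x
    & forall x y z, d x z <= d x y + d y z].

(* [+oo] when [H] is empty *)
Definition dist_set d x H : \bar R := ereal_inf [set (d x h)%:E | h in H].

Definition hausdorff_dist d A B : \bar R :=
  Order.max (ereal_sup [set dist_set d a B | a in A])
            (ereal_sup [set dist_set d b A | b in B]).

End distance_function.

Section geodesic.
Context {R : realType} {X : metricType R}.
Implicit Types (a b : R) (g : R -> X) (x y : X).

(* the counterpart of [total_variation] for curves in a metric space *)
Definition curve_length a b g : \bar R :=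
  ereal_sup
    [set (\sum_(0 <= n < size s)
            mdist (g (nth b (a :: s) n)) (g (nth b (a :: s) n.+1)))%:E
    | s in itv_partition a b].

Definition lipschitz_curve x y a b g : Prop :=
  [/\ a <= b, g a = x, g b = y &
      exists L : R, forall s t, s \in `[a, b] -> t \in `[a, b] ->
        mdist (g s) (g t) <= L * `|s - t|].

Definition lipschitz_curve_lengths x y : set (\bar R) :=
  [set l | exists a b g, lipschitz_curve x y a b g /\ l = curve_length a b g].

End geodesic.

Section set_assigned.
Context {R : realType}.

Definition is_length_space (X : metricType R) : Prop :=
  forall x y : X, (mdist x y)%:E = ereal_inf (lipschitz_curve_lengths x y).

Definition is_geodesic_space (X : metricType R) : Prop :=
  is_length_space X /\
  forall x y : X, lipschitz_curve_lengths x y (mdist x y)%:E.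

(* [X] is not assumed to be pointed, hence the explicit limit point instead of
   [completeType]. *)
Definition is_complete (X : metricType R) : Prop :=
  forall F : set_system X, ProperFilter F -> cauchy F -> exists x : X, F --> x.

Record set_assigned_geodesic (X : metricType R) (K : set X) : Prop := {
  sag_geodesic : is_geodesic_space X ;
  sag_complete : is_complete X ;
  sag_connected : connected [set: X] ;
  sag_locally_compact : locally_compact [set: X] ;
  sag_noncompact : ~ compact [set: X] ;
  sag_set_neq0 : K !=set0 ;
  sag_set_compact : compact K }.

Definition dist_sphere (X : metricType R) (K : set X) (r : R) : set X :=
  [set x | dist_set mdist x K = r%:E].

(* In a set-assigned geodesic space the spheres are nonempty, so that [fine]
   only discards finite values, and the limit exists. *)
Definition dl_function (X : metricType R) (K : set X) (x : X) : R :=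
  lim (fine (dist_set mdist x (dist_sphere K r)) - r @[r --> +oo]).

Definition admissible (X0 X1 : metricType R) : set (X0 + X1 -> X0 + X1 -> R) :=
  [set d | [/\ is_metric d,
               forall x y, d (inl x) (inl y) = mdist x y
             & forall x y, d (inr x) (inr y) = mdist x y]].

Definition GH_dist (X0 X1 : metricType R) (K0 : set X0) (K1 : set X1) : \bar R :=
  ereal_inf
    [set (hausdorff_dist d (range inl) (range inr)
          + hausdorff_dist d (inl @` K0) (inr @` K1))%E
    | d in @admissible X0 X1].

Definition is_net (X : metricType R) (e : R) (Y S : set X) : Prop :=
  S `<=` Y /\ forall y, Y y -> (dist_set mdist y S <= e%:E)%E.

Definition set_assigned_isometry (X0 X1 : metricType R)
    (K0 : set X0) (K1 : set X1) (e : R) (f : X0 -> X1) : Prop :=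
  [/\ (ereal_sup [set `|mdist x x' - mdist (f x) (f x')|%:E
                 | x in [set: X0] & x' in [set: X0]] < e%:E)%E,
      is_net e [set: X1] (range f)
    & is_net e K1 (f @` K0)].

End set_assigned.

(* Main.v *)
(** The excess [d(x, S_r(K)) - r] is nondecreasing for [r >= d(x, K)], because a
    geodesic from [x] to [S_s(K)] crosses [S_r(K)] when [r <= s]; it is bounded
    because [K] is, so [u_K(x)] is its supremum. Let [d] be an admissible metric
    with [a > d_H(X0, X1)], [b > d_H(K0, K1)] and [a + b = eps], and let [f]
    send each point to one at distance less than [max a b], and [K0] into [K1].
    A point of [S_(r+eps)(K0)] almost nearest to [x] is within [a] of a point of
    [X1] at distance at least [r] from [K1], and a geodesic from [f x] to the
    latter crosses [S_r(K1)]. This gives [u_K1(f x) <= u_K0(x) + 3 eps]; the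
    opposite inequality is symmetric. *)
Require Import Defs.
From HB Require Import structures.
From mathcomp Require Import all_boot all_order all_algebra.
From mathcomp Require Import all_classical all_reals all_analysis.
From mathcomp Require Import lra.

Set Implicit Arguments.
Unset Strict Implicit.
Unset Printing Implicit Defensive.

Import Order.TTheory GRing.Theory Num.Theory.
Import numFieldNormedType.Exports.

Local Open Scope classical_set_scope.
Local Open Scope ring_scope.

(** * Distance to a set, and geodesics crossing spheres *)

Section dist_to_set.
Context {R : realType} {X : metricType R}.
Implicit Types (x y : X) (H K : set X) (r s e : R).

(** [fine] turns the value [+oo] at an empty [H] into 0, hence the hypothesis [H !=set0] in several
    facts below. *)
Definition rdist x H : R := fine (dist_set mdist x H).

Lemma dist_set_le x H h : H h -> (dist_set mdist x H <= (mdist x h)%:E)%E.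
Proof. by move=> Hh; apply: ereal_inf_lbound; exists h. Qed.

Lemma dist_setE x H : H !=set0 -> dist_set mdist x H = (rdist x H)%:E.
Proof.
move=> [h Hh]; rewrite /rdist fineK// ge0_fin_numE.
  exact: le_lt_trans (dist_set_le x Hh) (ltry _).
by apply: le_ereal_inf_tmp => _ [k _ <-]; rewrite lee_fin mdist_ge0.
Qed.

Lemma rdist_le x H h : H h -> rdist x H <= mdist x h.
Proof.
by move=> Hh; rewrite -lee_fin -dist_setE; [exact: dist_set_le|exists h].
Qed.

Lemma rdist_adherent x H e : H !=set0 -> 0 < e ->
  exists2 h, H h & mdist x h < rdist x H + e.
Proof.
move=> H0 e0; have /ereal_inf_lt[_ [h Hh <-] hlt] :
    (dist_set mdist x H < (rdist x H + e)%:E)%E.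
  by rewrite dist_setE// lte_fin ltrDl.
by exists h; rewrite // -lte_fin.
Qed.

Lemma rdist_ge x H r : H !=set0 -> (forall h, H h -> r <= mdist x h) ->
  r <= rdist x H.
Proof.
move=> H0 rH; apply/ler_addgt0Pl => e e0; rewrite addrC.
have [h Hh /ltW] := rdist_adherent x H0 e0; exact: le_trans (rH _ Hh).
Qed.

Lemma rdist_in x H : H x -> rdist x H = 0.
Proof.
move=> Hx; apply/eqP; rewrite eq_le -{1}(mdistxx x) rdist_le//=.
by apply: rdist_ge => [|h _]; [exists x|exact: mdist_ge0].
Qed.

Lemma rdist_lipschitz x y H : H !=set0 -> rdist x H <= mdist x y + rdist y H.
Proof.
move=> H0; rewrite -lerBlDl; apply: rdist_ge => // h Hh.
rewrite lerBlDl; exact: le_trans (rdist_le x Hh) (metric_triangle _ _ _).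
Qed.

Lemma dist_sphereE K r : K !=set0 -> dist_sphere K r = [set x | rdist x K = r].
Proof.
move=> K0; apply/seteqP; split => x; rewrite /dist_sphere /= dist_setE//.
  by case.
by move->.
Qed.

Lemma compact_mdist_bounded x K : compact K ->
  exists M, forall k, K k -> mdist x k <= M.
Proof.
move=> cK; have cd : continuous (mdist x).
  move=> y; apply/cvgrPdist_lt => e e0.
  near=> z; have : mdist y z < e.
    by near: z; have := nbhsx_ballx y e e0; rewrite ballEmdist.
  have := metric_triangle x y z; have := metric_triangle x z y.
  by rewrite (metric_sym z y) ltr_norml; lra.
have [M [_ MK]] :=
  compact_bounded (continuous_compact (continuous_subspaceT cd) cK).
(* [compact_bounded] provides a bound only for numbers strictly above [M]. *)
exists (M + 1) => k Kk; apply: le_trans (ler_norm _) _.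
by apply: (MK (M + 1)); [rewrite ltrDl|exists k].
Unshelve. all: by end_near. Qed.

(* The point is where a minimizing curve from [x] to [z] meets the sphere. *)
Lemma geodesic_cross_sphere K x z r : is_geodesic_space X -> K !=set0 ->
  rdist x K <= r <= rdist z K ->
  exists2 w, dist_sphere K r w & mdist x w + mdist w z <= mdist x z.
Proof.
move=> [_ geo] K0 /andP[xr rz].
have [a [b [g [[ab ga gb [L gL]] len]]]] := geo x z.
have cont : {within `[a, b], continuous (fun t => rdist (g t) K)}.
  apply/subspace_continuousP => s sab; apply/cvgrPdist_lt => e e0.
  have L0 : 0 < `|L| + 1 by rewrite ltr_wpDl.
  rewrite near_withinE; near=> t => tab.
  have st : `|s - t| < e / (`|L| + 1).
    near: t; apply: cvgr_dist_lt; first exact: cvg_id.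
    exact: divr_gt0.
  have lt_e : mdist (g s) (g t) < e.
    apply: le_lt_trans (gL _ _ sab tab) _.
    apply: (@le_lt_trans _ _ ((`|L| + 1) * `|s - t|)).
      by rewrite ler_wpM2r// (le_trans (ler_norm _))// lerDl.
    by rewrite mulrC -ltr_pdivlMr.
  have := rdist_lipschitz (g s) (g t) K0.
  have := rdist_lipschitz (g t) (g s) K0.
  by rewrite (metric_sym (g t)) ltr_norml /from_subspace; lra.
have [|t] := @IVT _ _ a b r ab cont.
  by rewrite ga gb ge_min xr le_max rz orbT.
rewrite in_itv /= => /andP[ta tb] tr; exists (g t).
  by rewrite dist_sphereE.
(* An [itv_partition] is strictly increasing, so [t = a] and [t = b] are treated apart. Otherwise
   [[:: t; b]] bounds the length below by two chords. *)
move: ta; rewrite le_eqVlt => /orP[/eqP <-|ta].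
  by rewrite ga mdistxx add0r.
move: tb; rewrite le_eqVlt => /orP[/eqP ->|tb].
  by rewrite gb mdistxx addr0.
rewrite -lee_fin len; apply: ereal_sup_ubound; exists [:: t; b].
  by rewrite /itv_partition /= ta tb eqxx.
by rewrite big_nat_recr//= big_nat1 /= ga gb.
Unshelve. all: by end_near. Qed.

End dist_to_set.

(** * Convergence and comparison of dl-functions *)

Section dl_function.
Context {R : realType}.
Implicit Types X Y : metricType R.

(** For nonempty compact [K] this is unboundedness of [X], which makes the spheres nonempty. *)
Definition reaches_infinity X (K : set X) := forall r, exists z, r <= rdist z K.

Lemma dist_sphere_neq0 X (K : set X) r : set_assigned_geodesic K ->
  reaches_infinity K -> 0 <= r -> dist_sphere K r !=set0.
Proof.
move=> hK infK r0; have [k Kk] := sag_set_neq0 hK; have [z rz] := infK r.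
have [|w] := geodesic_cross_sphere (x := k) (r := r) (z := z)
  (sag_geodesic hK) (sag_set_neq0 hK).
  by rewrite rdist_in// r0.
by exists w.
Qed.

(** A geodesic from [x] to a point [z] of the outer sphere meets the inner one at some [w], and
    [d(w, z) >= s - r] because the distance to [K] is 1-Lipschitz. *)
Lemma sphere_excess_nondecreasing X (K : set X) x r s :
    set_assigned_geodesic K -> reaches_infinity K ->
    rdist x K <= r -> r <= s ->
  rdist x (dist_sphere K r) - r <= rdist x (dist_sphere K s) - s.
Proof.
move=> hK infK xr rs; have K0 := sag_set_neq0 hK.
have r0 : 0 <= r.
  by apply: le_trans xr; apply: rdist_ge => // ? _; exact: mdist_ge0.
rewrite lerBrDr; apply: rdist_ge; first exact/dist_sphere_neq0/(le_trans r0).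
move=> z; rewrite dist_sphereE//= => zs.
have [|w Sw xwz] := geodesic_cross_sphere (x := x) (r := r) (z := z)
  (sag_geodesic hK) K0; first by rewrite xr zs.
have := rdist_le x Sw; have := rdist_lipschitz z w K0; move: Sw.
by rewrite dist_sphereE//= zs (metric_sym z); lra.
Qed.

(** A point [z] of the sphere is reached from [x] through an almost nearest [k] in [K], with
    [d(x, k) <= M] and [d(k, z) < r + 1]. *)
Lemma sphere_excess_bounded X (K : set X) x : set_assigned_geodesic K ->
    reaches_infinity K ->
  exists M, forall r, 0 <= r -> rdist x (dist_sphere K r) - r <= M.
Proof.
move=> hK infK; have K0 := sag_set_neq0 hK.
have [M KM] := compact_mdist_bounded x (sag_set_compact hK).
exists (M + 1) => r r0; have [z Sz] := dist_sphere_neq0 hK infK r0.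
have := rdist_le x Sz; move: Sz; rewrite dist_sphereE//= => zr.
have [k Kk] := rdist_adherent z K0 ltr01; have := KM _ Kk.
by have := metric_triangle x k z; rewrite (metric_sym k) zr; lra.
Qed.

Lemma dl_function_cvg X (K : set X) x : set_assigned_geodesic K ->
    reaches_infinity K ->
  rdist x (dist_sphere K r) - r @[r --> +oo] --> dl_function K x.
Proof.
move=> hK infK; suff : cvg (rdist x (dist_sphere K r) - r @[r --> +oo]) by [].
pose phi r := rdist x (dist_sphere K r) - r.
pose r0 := rdist x K.
have r0_ge0 : 0 <= r0.
  by apply: rdist_ge (sag_set_neq0 hK) _ => ? _; exact: mdist_ge0.
(* Monotonicity is known only from [r0] on; precomposing with [max r0] makes it global and changes
   nothing near [+oo]. *)
have phi_eq : {near +oo, (fun r => phi (Num.max r0 r)) =1 phi}.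
  by near=> r; rewrite max_r//; near: r; exact: nbhs_pinfty_ge.
apply/cvg_ex; eexists; apply: cvg_trans (near_eq_cvg phi_eq) _.
apply: nondecreasing_cvgr.
  move=> r s rs; apply: sphere_excess_nondecreasing => //.
    by rewrite le_max lexx.
  by rewrite ge_max !le_max lexx rs orbT.
have [M phiM] := sphere_excess_bounded x hK infK.
by exists M => _ [r _ <-]; apply: phiM; rewrite le_max r0_ge0.
Unshelve. all: by end_near. Qed.

Lemma sphere_excess_le_dl_function X (K : set X) x r :
    set_assigned_geodesic K -> reaches_infinity K -> rdist x K <= r ->
  rdist x (dist_sphere K r) - r <= dl_function K x.
Proof.
move=> hK infK xr; apply: (cvgr_to_ge (@dl_function_cvg X K x hK infK)).
by near=> s; apply: sphere_excess_nondecreasing => //.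
Unshelve. all: by end_near. Qed.

(* A point of [X] far from [K] is matched with a point of [Y] that lies beyond a
   slightly smaller sphere around [L], which a geodesic from [y] must cross. *)
Lemma dl_function_le X Y (K : set X) (L : set Y) x y c e :
    set_assigned_geodesic K -> set_assigned_geodesic L ->
    reaches_infinity K -> reaches_infinity L -> 0 <= e ->
    (forall w, exists v, mdist y v <= mdist x w + c /\
                         rdist w K - e <= rdist v L) ->
  dl_function L y <= dl_function K x + e + c.
Proof.
move=> hK hL infK infL e0 xy.
have K0 := sag_set_neq0 hK; have L0 := sag_set_neq0 hL.
apply: (cvgr_to_le (@dl_function_cvg Y L y hL infL)); near=> r.
have r0 : 0 <= r by near: r; exact: nbhs_pinfty_ge.
have re0 : 0 <= r + e by exact: addr_ge0.
have xr : rdist x K <= r + e.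
  by rewrite -lerBlDr; near: r; exact/nbhs_pinfty_ge/num_real.
have yr : rdist y L <= r by near: r; exact/nbhs_pinfty_ge/num_real.
apply/ler_addgt0Pl => d d0.
(* The radius [r + e] absorbs the loss [e], so the partner [v] of [w] is at distance at least [r]
   from [L]. *)
have [w Sw xw] := rdist_adherent x (dist_sphere_neq0 hK infK re0) d0.
have := sphere_excess_le_dl_function hK infK xr.
have [v [yv wv]] := xy w.
have wr : rdist w K = r + e by move: Sw; rewrite dist_sphereE.
have [|u Su] := geodesic_cross_sphere (x := y) (r := r) (z := v)
    (sag_geodesic hL) L0.
  by rewrite yr /=; lra.
by have := rdist_le y Su; have := mdist_ge0 u v; lra.
Unshelve. all: by end_near. Qed.

(* By the Hopf-Rinow theorem this case does not occur. Rather than proving that,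
   observe that here the spheres of large radius are empty, [fine +oo = 0], and
   the value of the divergent limit does not depend on the space. *)
Lemma dl_function_bounded X (K : set X) x : K !=set0 -> ~ reaches_infinity K ->
  dl_function K x = lim (- r @[r --> +oo]).
Proof.
move=> K0 /existsNP[M /forallNP KM].
have E : {near +oo, (fun r => rdist x (dist_sphere K r) - r) =1 -%R}.
  near=> r; have Mr : M <= r by near: r; exact/nbhs_pinfty_ge/num_real.
  suff -> : dist_sphere K r = set0.
    by rewrite /rdist /dist_set image_set0 ereal_inf0 /= sub0r.
  rewrite dist_sphereE//; apply/seteqP; split => // z /= zr.
  by have := KM z; rewrite zr.
have E' : {near +oo, -%R =1 (fun r => rdist x (dist_sphere K r) - r)}.
  by apply: filterS E => r.
(* Without convergence, equality of the limits comes from equality of the filters, one inclusion at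
   a time. *)
rewrite /dl_function; congr (lim _); apply/seteqP; split => A.
  exact: (near_eq_cvg E).
exact: (near_eq_cvg E').
Unshelve. all: by end_near. Qed.

End dl_function.

(** * Consequences of a small Hausdorff distance *)

Section hausdorff.
Context {R : realType}.

Lemma hausdorff_dist_ltl T (d : T -> T -> R) (A B : set T) (a : R) x :
  (hausdorff_dist d A B < a%:E)%E -> A x -> exists2 y, B y & d x y < a.
Proof.
rewrite gt_max => /andP[supA _] Ax.
have /ereal_inf_lt[_ [y By <-]] : (dist_set d x B < a%:E)%E.
  by apply: le_lt_trans supA; apply: ereal_sup_ubound; exists x.
by rewrite lte_fin; exists y.
Qed.

Lemma hausdorff_distC T (d : T -> T -> R) (A B : set T) :
  hausdorff_dist d A B = hausdorff_dist d B A.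
Proof. exact: maxC. Qed.

Lemma hausdorff_dist_ge0 T (d : T -> T -> R) (A B : set T) :
  (forall x y, 0 <= d x y) -> A !=set0 -> (0 <= hausdorff_dist d A B)%E.
Proof.
move=> d0 [x Ax]; rewrite le_max; apply/orP; left.
apply: le_ereal_sup_tmp; exists (dist_set d x B); first by exists x.
by apply: le_ereal_inf_tmp => _ [y _ <-]; rewrite lee_fin.
Qed.

(** Sharing the slack gives each Hausdorff distance its own strict real bound, from which points can
    be chosen. *)
Lemma adde_lt_split (u v : \bar R) (e : R) :
    (0 <= u)%E -> (0 <= v)%E -> (u + v < e%:E)%E ->
  exists a b, [/\ (u < a%:E)%E, (v < b%:E)%E & a + b = e].
Proof.
case: u v => [r| |] [s| |] //= _ _; rewrite -EFinD lte_fin => rse.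
exists (r + (e - r - s) / 2), (s + (e - r - s) / 2).
by rewrite !lte_fin; split; lra.
Qed.

(** Each [l] in [L] has some [k] in [K] within [b], and [w] reaches [k] through [v] and [l]. Keeping
    [i] and [j] abstract lets [inl] and [inr] be exchanged. *)
Lemma rdist_image_le T (d : T -> T -> R) (X Y : metricType R) (i : X -> T)
    (j : Y -> T) (K : set X) (L : set Y) (a b : R) w v :
    is_metric d -> (forall x x', d (i x) (i x') = mdist x x') ->
    (forall y y', d (j y) (j y') = mdist y y') -> L !=set0 ->
    (hausdorff_dist d (i @` K) (j @` L) < b%:E)%E -> d (i w) (j v) < a ->
  rdist w K - (a + b) <= rdist v L.
Proof.
move=> [_ _ dC dT] iE jE L0 KL wv; apply: rdist_ge => // l Ll.
rewrite hausdorff_distC in KL.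
have [|_ [k Kk <-] lk] := hausdorff_dist_ltl (x := j l) KL; first by exists l.
have := rdist_le w Kk; have := dT (i w) (j v) (i k).
by have := dT (j v) (j l) (i k); rewrite iE jE; lra.
Qed.

End hausdorff.

(** * The approximate isometry and its effect on dl-functions *)

Theorem theorem1p16 (R : realType) (X0 X1 : metricType R)
    (K0 : set X0) (K1 : set X1) (eps : R)
    (h0 : set_assigned_geodesic K0) (h1 : set_assigned_geodesic K1)
    (hGH : (GH_dist K0 K1 < eps%:E)%E) :
  exists f : X0 -> X1,
    set_assigned_isometry K0 K1 (2 * eps) f /\
    forall x0 : X0, `|dl_function K0 x0 - dl_function K1 (f x0)| < 10 * eps.
Proof.
have K00 := sag_set_neq0 h0; have K10 := sag_set_neq0 h1.
have [_ [d [dM d0E d1E] <-]] := ereal_inf_lt hGH.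
have [d_ge0 _ dC dT] := dM.
have [k0 Kk0] := K00.
have HX_ge0 : (0 <= hausdorff_dist d (range inl) (range inr))%E.
  by apply: hausdorff_dist_ge0 => //; exists (inl k0), k0.
have HK_ge0 : (0 <= hausdorff_dist d (inl @` K0) (inr @` K1))%E.
  by apply: hausdorff_dist_ge0 => //; exists (inl k0), k0.
move=> /(adde_lt_split HX_ge0 HK_ge0)[a [b [HXa HKb abE]]].
have a0 : 0 < a by rewrite -lte_fin; exact: le_lt_trans HXa.
have b0 : 0 < b by rewrite -lte_fin; exact: le_lt_trans HKb.
have HXa' := HXa; rewrite hausdorff_distC in HXa'.
have HKb' := HKb; rewrite hausdorff_distC in HKb'.
have X01 x : exists y, d (inl x) (inr y) < a.
  have [|_ [y _ <-]] := hausdorff_dist_ltl (x := inl x) HXa; first by exists x.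
  by exists y.
have X10 y : exists x, d (inr y) (inl x) < a.
  have [|_ [x _ <-]] := hausdorff_dist_ltl (x := inr y) HXa'; first by exists y.
  by exists x.
have K01 x : K0 x -> exists2 y, K1 y & d (inl x) (inr y) < b.
  move=> Kx; have [|_ [y Ky <-]] := hausdorff_dist_ltl (x := inl x) HKb.
    by exists x.
  by exists y.
have K10' y : K1 y -> exists2 x, K0 x & d (inr y) (inl x) < b.
  move=> Ky; have [|_ [x Kx <-]] := hausdorff_dist_ltl (x := inr y) HKb'.
    by exists y.
  by exists x.
(* Points of [K0] must land in [K1] and move by less than [b], the others by less than [a]. Since
   both are positive with sum [eps], [m < eps]. *)
pose m := Num.max a b.
have am : a <= m by rewrite le_max lexx.
have bm : b <= m by rewrite le_max lexx orbT.
have meps : m < eps by rewrite gt_max; apply/andP; split; lra.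
have fex x : exists y, d (inl x) (inr y) < m /\ (K0 x -> K1 y).
  have [Kx|nKx] := pselect (K0 x).
    by have [y Ky xy] := K01 x Kx; exists y; split => //; lra.
  by have [y xy] := X01 x; exists y; split => //; lra.
have [f fP] := choice fex.
have xfx x : d (inl x) (inr (f x)) < m by case: (fP x).
exists f; split; first split.
(* A supremum keeps only a weak bound, so strictness is drawn from [m < eps]. *)
- apply: (@le_lt_trans _ _ (2 * m)%:E); last by rewrite lte_fin; lra.
  apply: ge_ereal_sup => _ [x _ [x' _ <-]]; rewrite lee_fin -d0E -d1E.
  have := dT (inl x) (inr (f x)) (inl x'); have := xfx x.
  have := dT (inr (f x)) (inr (f x')) (inl x'); have := xfx x'.
  have := dT (inr (f x)) (inl x) (inr (f x')).
  have := dT (inl x) (inl x') (inr (f x')).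
  rewrite (dC (inr (f x')) (inl x')) (dC (inr (f x)) (inl x)) ler_norml; lra.
- split=> // y _; have [x yx] := X10 y.
  apply: (@le_trans _ _ (mdist y (f x))%:E).
    by apply: dist_set_le; exists x.
  have := xfx x; have := dT (inr y) (inl x) (inr (f x)).
  by rewrite lee_fin -d1E; lra.
- split=> [_ [x Kx <-]|y Ky]; first by have [_ /(_ Kx)] := fP x.
  have [x Kx yx] := K10' y Ky.
  apply: (@le_trans _ _ (mdist y (f x))%:E).
    by apply: dist_set_le; exists x.
  have := xfx x; have := dT (inr y) (inl x) (inr (f x)).
  by rewrite lee_fin -d1E; lra.
have far01 w v : d (inl w) (inr v) < a -> rdist w K0 - eps <= rdist v K1.
  by rewrite -abE; exact: rdist_image_le HKb.
have far10 w v : d (inr w) (inl v) < a -> rdist w K1 - eps <= rdist v K0.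
  by rewrite -abE; exact: rdist_image_le HKb'.
move=> x0; have x0f := xfx x0.
(* Matching points shows that both spaces are bounded or both unbounded; in the bounded case the two
   values are the same [lim]. *)
have [inf0|fin0] := pselect (reaches_infinity K0); last first.
  have fin1 : ~ reaches_infinity K1.
    apply: contra_not fin0 => inf1 r; have [w rw] := inf1 (r + eps).
    by have [v /far10 wv] := X10 w; exists v; lra.
  by rewrite !dl_function_bounded// subrr normr0; lra.
have inf1 : reaches_infinity K1.
  move=> r; have [w rw] := inf0 (r + eps).
  by have [v /far01 wv] := X01 w; exists v; lra.
have eps0 : 0 <= eps by lra.
(* Here [2 * eps] covers [m] from [f x0] to [x0] and [a] from [w] to [v]. *)
have le01 : dl_function K1 (f x0) <= dl_function K0 x0 + eps + 2 * eps.
  apply: dl_function_le => // w; have [v wv] := X01 w.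
  exists v; split; last exact: far01.
  have := dT (inr (f x0)) (inl x0) (inr v); have := dT (inl x0) (inl w) (inr v).
  by rewrite d0E d1E (dC (inr (f x0)) (inl x0)); lra.
have le10 : dl_function K0 x0 <= dl_function K1 (f x0) + eps + 2 * eps.
  apply: dl_function_le => // w; have [v wv] := X10 w.
  exists v; split; last exact: far10.
  have := dT (inl x0) (inr (f x0)) (inl v).
  have := dT (inr (f x0)) (inr w) (inl v).
  by rewrite d0E d1E; lra.
by rewrite ltr_norml; lra.
Qed.
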